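(* Let $(\mathcal{P},\mu,\Delta,(\alpha_i)_{i=1,2})$ be a finite-dimensional partially hom-associative ternary infinitesimal bialgebra over a field $\mathcal{K}$ of characteristic zero. Then $(\mathcal{P}^*,\Delta^*,\mu^*,(\alpha_i^* )_{i=1,2})$ is a partially hom-associative ternary infinitesimal bialgebra (with ternary product $\Delta^*$, ternary coproduct $\mu^*$ and twisting maps $\alpha_1^*,\alpha_2^*$).
   Context: A partially hom-associative ternary infinitesimal bialgebra $(\mathcal{A},\mu,\Delta,(\alpha_i)_{i=1,2})$ is a vector space $\mathcal{A}$ with linear maps $\mu:\mathcal{A}^{\otimes3}\to\mathcal{A}$, $\Delta:\mathcal{A}\to\mathcal{A}^{\otimes3}$, $\alpha_1,\alpha_2:\mathcal{A}\to\mathcal{A}$ such that: (1) $(\mathcal{A},\mu,(\alpha_i))$ is a partially hom-associative ternary algebra: for all $x_1,\dots,x_5\in\mathcal{A}$, $\mu(\mu(x_1,x_2,x_3),\alpha_1(x_4),\alpha_2(x_5))+\mu(\alpha_1(x_1),\mu(x_2,x_3,x_4),\alpha_2(x_5))+\mu(\alpha_1(x_1),\alpha_2(x_2),\mu(x_3,x_4,x_5))=0$; (2) $(\mathcal{A},\Delta,(\alpha_i))$ is a partially hom-coassociative ternary coalgebra: $(\Delta\otimes\alpha_1\otimes\alpha_2+\alpha_1\otimes\Delta\otimes\alpha_2+\alpha_1\otimes\alpha_2\otimes\Delta)\circ\Delta=0$; (3) for all $x,y,z\in\mathcal{A}$, $$\Delta\mu(x,y,z)=(L_\mu(\alpha_1(x),\alpha_2(y))\otimes\alpha_1\otimes\alpha_2)\Delta(z)+(\alpha_1\otimes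 M_\mu(\alpha_1(x),\alpha_2(z))\otimes\alpha_2)\Delta(y)+(\alpha_1\otimes\alpha_2\otimes R_\mu(\alpha_1(y),\alpha_2(z)))\Delta(x),$$ where $L_\mu(x,y)(z)=\mu(x,y,z)$, $R_\mu(x,y)(z)=\mu(z,x,y)$, $M_\mu(x,y)(z)=\mu(x,z,y)$. Dual maps: with $\langle\xi,x\rangle=\xi(x)$ and $\langle\xi\otimes\eta\otimes\gamma,x\otimes y\otimes z\rangle=\langle\xi,x\rangle\langle\eta,y\rangle\langle\gamma,z\rangle$, put $\langle\alpha^*(f),x\rangle=\langle f,\alpha(x)\rangle$, $\langle\Delta^*(\xi,\eta,\gamma),x\rangle=\langle\xi\otimes\eta\otimes\gamma,\Delta(x)\rangle$ and $\langle\mu^*(\xi),x\otimes y\otimes z\rangle=\langle\xi,\mu(x,y,z)\rangle$. *)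

(* Defs.v *)
From HB Require Import structures.
From mathcomp Require Import all_boot all_order all_algebra.

Set Implicit Arguments.
Unset Strict Implicit.
Unset Printing Implicit Defensive.

Import GRing.Theory.
Local Open Scope ring_scope.

(* Tensor products of finite-dimensional spaces. The carrier is the space of
   coordinate matrices in the bases vbasis {:U} and vbasis {:V}; [tlift_pure]
   and [tensor_ext] are its universal property, which is all that is used
   below. *)

Definition tensor (K : fieldType) (U V : vectType K) : vectType K :=
  'M[K]_(\dim {:U}, \dim {:V}).

Definition tpure (K : fieldType) (U V : vectType K) (u : U) (v : V) :
    tensor U V :=
  \matrix_(i, j) (coord (vbasis {:U}) i u * coord (vbasis {:V}) j v).

Notation "u '⊗' v" := (tpure u v)
  (at level 41, right associativity, format "u  '⊗'  v") : ring_scope.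

Definition tlift_fun (K : fieldType) (U V W : vectType K) (f : U -> V -> W)
    (t : tensor U V) : W :=
  \sum_i \sum_j (t : 'M[K]_(\dim {:U}, \dim {:V})) i j *:
    f (vbasis {:U})`_i (vbasis {:V})`_j.

(* The linear map on tensor U V induced by a bilinear f. *)
Definition tlift (K : fieldType) (U V W : vectType K) (f : U -> V -> W) :
  'Hom(tensor U V, W) := linfun (tlift_fun f).

Section Tensor.
Variable K : fieldType.
Implicit Types U V W : vectType K.

Fact tlift_fun_is_linear U V W (f : U -> V -> W) : linear (tlift_fun f).
Proof.
move=> a s t; rewrite /tlift_fun scaler_sumr -big_split /=.
apply: eq_bigr => i _; rewrite scaler_sumr -big_split /=.
by apply: eq_bigr => j _; rewrite !mxE scalerDl scalerA.
Qed.

HB.instance Definition _ U V W (f : U -> V -> W) :=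
  GRing.isLinear.Build K (tensor U V) W *:%R (tlift_fun f)
    (tlift_fun_is_linear f).

Lemma tpure_bilinear U V :
  bilinear_for *:%R *:%R (@tpure K U V : U -> V -> tensor U V).
Proof.
split=> w a u v; apply/matrixP => i j; rewrite !mxE linearP /=.
  by rewrite mulrDl -mulrA.
by rewrite mulrDr mulrCA.
Qed.

Lemma tlift_pure U V W (f : U -> V -> W) :
  bilinear_for *:%R *:%R f -> forall u v, tlift f (u ⊗ v) = f u v.
Proof.
move=> [fl fr] u v; rewrite lfunE /= /tlift_fun.
pose flL v' : {linear U -> W} :=
  HB.pack (f^~ v') (GRing.isLinear.Build K U W *:%R (f^~ v') (fl v')).
pose frL u' : {linear V -> W} :=
  HB.pack (f u') (GRing.isLinear.Build K V W *:%R (f u') (fr u')).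
rewrite -[RHS]/(flL v u) {2}(coord_vbasis (memvf u)) linear_sum.
apply: eq_bigr => i _; rewrite linearZ /=.
rewrite -[X in _ *: X]/(frL _ v) {2}(coord_vbasis (memvf v)) linear_sum.
rewrite scaler_sumr; apply: eq_bigr => j _.
by rewrite linearZ /= scalerA !mxE.
Qed.

Lemma tensor_ext U V W (f g : 'Hom(tensor U V, W)) :
  (forall u v, f (u ⊗ v) = g (u ⊗ v)) -> f = g.
Proof.
move=> fg; apply/lfunP => t; rewrite [t](matrix_sum_delta (t : 'M_(_, _))).
rewrite !linear_sum; apply: eq_bigr => i _; rewrite !linear_sum.
apply: eq_bigr => j _; rewrite !linearZ; congr (_ *: _).
suff -> : delta_mx i j = (vbasis {:U})`_i ⊗ (vbasis {:V})`_j by exact: fg.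
apply/matrixP => k l; rewrite !mxE !coord_free ?(basis_free (vbasisP _)) //.
by rewrite -natrM mulnb (eq_sym k) (eq_sym l).
Qed.

End Tensor.

Section TensorMaps.
Variable K : fieldType.
Implicit Types U V W X Y Z : vectType K.

Definition tmap U V W X (f : 'Hom(U, W)) (g : 'Hom(V, X)) :
  'Hom(tensor U V, tensor W X) := tlift (fun u v => f u ⊗ g v).

Definition tassoc_at U V W (w : W) : 'Hom(tensor U V, tensor U (tensor V W)) :=
  tlift (fun u v => u ⊗ v ⊗ w).

Definition tassoc U V W :
  'Hom(tensor (tensor U V) W, tensor U (tensor V W)) :=
  tlift (fun t w => tassoc_at U V w t).

Lemma tmap_pure U V W X (f : 'Hom(U, W)) (g : 'Hom(V, X)) u v :
  tmap f g (u ⊗ v) = f u ⊗ g v.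
Proof.
have [l r] := tpure_bilinear W X.
rewrite tlift_pure //; split=> w a s t; rewrite linearP; [exact: l|exact: r].
Qed.

Lemma tassoc_at_pure U V W (w : W) (u : U) (v : V) :
  tassoc_at U V w (u ⊗ v) = u ⊗ v ⊗ w.
Proof.
have [l r] := tpure_bilinear U (tensor V W).
have [l' r'] := tpure_bilinear V W.
rewrite tlift_pure //; split=> z a s t; first exact: l.
by rewrite l' r.
Qed.

Lemma tassoc_pure U V W (u : U) (v : V) (w : W) :
  tassoc U V W ((u ⊗ v) ⊗ w) = u ⊗ v ⊗ w.
Proof.
have [l r] := tpure_bilinear U (tensor V W).
have [l' r'] := tpure_bilinear V W.
rewrite tlift_pure ?tassoc_at_pure //; split=> t a s z; first exact: linearP.
have -> : tassoc_at U V (a *: s + z) = a *: tassoc_at U V s + tassoc_at U V z.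
  apply: tensor_ext => u' v'; rewrite add_lfunE scale_lfunE !tassoc_at_pure.
  by rewrite r' r.
by rewrite add_lfunE scale_lfunE.
Qed.

Definition tensor3 U : vectType K := tensor U (tensor U U).
Definition tensor5 U : vectType K :=
  tensor U (tensor U (tensor U (tensor U U))).

Definition tmap3 U V W X Y Z
    (f : 'Hom(U, X)) (g : 'Hom(V, Y)) (h : 'Hom(W, Z)) :
  'Hom(tensor U (tensor V W), tensor X (tensor Y Z)) := tmap f (tmap g h).

(* The rebracketings onto tensor5 U of terms such as (a ⊗ b ⊗ c) ⊗ d ⊗ e
   and a ⊗ (b ⊗ c ⊗ d) ⊗ e; since ⊗ associates to the right,
   a ⊗ b ⊗ (c ⊗ d ⊗ e) needs none. *)
Definition flat1 U : 'Hom(tensor (tensor3 U) (tensor U U), tensor5 U) :=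
  (tmap \1 (tassoc U U (tensor U U)) \o tassoc U (tensor U U) (tensor U U))%VF.

Definition flat2 U : 'Hom(tensor U (tensor (tensor3 U) U), tensor5 U) :=
  tmap \1 (tmap \1 (tassoc U U U) \o tassoc U (tensor U U) U)%VF.

Lemma flat1_pure U (a b c d e : U) :
  flat1 U ((a ⊗ b ⊗ c) ⊗ d ⊗ e) = a ⊗ b ⊗ c ⊗ d ⊗ e.
Proof.
by rewrite comp_lfunE tassoc_pure tmap_pure tassoc_pure id_lfunE.
Qed.

Lemma flat2_pure U (a b c d e : U) :
  flat2 U (a ⊗ (b ⊗ c ⊗ d) ⊗ e) = a ⊗ b ⊗ c ⊗ d ⊗ e.
Proof.
by rewrite tmap_pure comp_lfunE tassoc_pure tmap_pure tassoc_pure !id_lfunE.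
Qed.

End TensorMaps.

Section Bialgebra.
Variables (K : fieldType) (A : vectType K).
Implicit Types (mu : 'Hom(tensor3 A, A)) (Delta : 'Hom(A, tensor3 A)).

Definition L_mu mu (x y : A) : 'End(A) := linfun (fun z => mu (x ⊗ y ⊗ z)).
Definition R_mu mu (x y : A) : 'End(A) := linfun (fun z => mu (z ⊗ x ⊗ y)).
Definition M_mu mu (x y : A) : 'End(A) := linfun (fun z => mu (x ⊗ z ⊗ y)).

Definition partially_hom_assoc mu (alpha1 alpha2 : 'End(A)) : Prop :=
  forall x1 x2 x3 x4 x5 : A,
    mu (mu (x1 ⊗ x2 ⊗ x3) ⊗ alpha1 x4 ⊗ alpha2 x5)
  + mu (alpha1 x1 ⊗ mu (x2 ⊗ x3 ⊗ x4) ⊗ alpha2 x5)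
  + mu (alpha1 x1 ⊗ alpha2 x2 ⊗ mu (x3 ⊗ x4 ⊗ x5)) = 0.

Definition partially_hom_coassoc Delta (alpha1 alpha2 : 'End(A)) : Prop :=
  (((flat1 A \o tmap3 Delta alpha1 alpha2)
    + (flat2 A \o tmap3 alpha1 Delta alpha2)
    + tmap3 alpha1 alpha2 Delta) \o Delta)%VF = 0.

Definition inf_compatible mu Delta (alpha1 alpha2 : 'End(A)) : Prop :=
  forall x y z : A,
    Delta (mu (x ⊗ y ⊗ z)) =
      tmap3 (L_mu mu (alpha1 x) (alpha2 y)) alpha1 alpha2 (Delta z)
    + tmap3 alpha1 (M_mu mu (alpha1 x) (alpha2 z)) alpha2 (Delta y)
    + tmap3 alpha1 alpha2 (R_mu mu (alpha1 y) (alpha2 z)) (Delta x).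

Record partially_hom_assoc_inf_bialgebra mu Delta
    (alpha1 alpha2 : 'End(A)) : Prop := {
  bialg_assoc : partially_hom_assoc mu alpha1 alpha2;
  bialg_coassoc : partially_hom_coassoc Delta alpha1 alpha2;
  bialg_compat : inf_compatible mu Delta alpha1 alpha2
}.

Lemma trilinear_pure mu :
  [/\ forall y z, linear (fun x => mu (x ⊗ y ⊗ z)),
      forall x z, linear (fun y => mu (x ⊗ y ⊗ z)) &
      forall x y, linear (fun z => mu (x ⊗ y ⊗ z))].
Proof.
have [l r] := tpure_bilinear A (tensor A A).
have [l' r'] := tpure_bilinear A A.
split=> [y z|x z|x y] a s t; rewrite -linearP; congr (mu _).
- exact: l.
- by rewrite l' r.
- by rewrite r' r.
Qed.

Lemma linfun_linearE (U V : vectType K) (f : U -> V) :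
  linear f -> linfun f =1 f.
Proof.
move=> lf x.
pose fL := HB.pack f (GRing.isLinear.Build K U V *:%R f lf) : {linear U -> V}.
exact: (lfunE fL x).
Qed.

Lemma L_muE mu x y z : L_mu mu x y z = mu (x ⊗ y ⊗ z).
Proof. by rewrite linfun_linearE //; case: (trilinear_pure mu). Qed.
Lemma R_muE mu x y z : R_mu mu x y z = mu (z ⊗ x ⊗ y).
Proof. by rewrite linfun_linearE //; case: (trilinear_pure mu). Qed.
Lemma M_muE mu x y z : M_mu mu x y z = mu (x ⊗ z ⊗ y).
Proof. by rewrite linfun_linearE //; case: (trilinear_pure mu). Qed.

End Bialgebra.

Definition dual (K : fieldType) (V : vectType K) : vectType K := 'Hom(V, K^o).

Definition ev (K : fieldType) (V : vectType K) (xi : dual V) (x : V) : K :=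
  (xi : 'Hom(V, K^o)) x.

Section Dual.
Variable K : fieldType.
Implicit Types U V W X : vectType K.

Definition dual_map U V (f : 'Hom(U, V)) : 'Hom(dual V, dual U) :=
  linfun (fun xi : 'Hom(V, K^o) => (xi \o f)%VF : dual U).

Definition tpair_form U V (xi : dual U) (eta : dual V) : dual (tensor U V) :=
  tlift (fun u v => ev xi u * ev eta v : K^o).

Definition tpair U V : 'Hom(tensor (dual U) (dual V), dual (tensor U V)) :=
  tlift (@tpair_form U V).

Definition tpair3 V : 'Hom(tensor3 (dual V), dual (tensor3 V)) :=
  (tpair V (tensor V V) \o tmap \1 (tpair V V))%VF.

Definition dual_prod V (Delta : 'Hom(V, tensor3 V)) :
  'Hom(tensor3 (dual V), dual V) := (dual_map Delta \o tpair3 V)%VF.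

(* (tpair3 V)^-1 is a two-sided inverse, by [tpair3_bij]; [dual_coprodE] is the
   defining duality of mu and dual_coprod mu. *)
Definition dual_coprod V (mu : 'Hom(tensor3 V, V)) :
  'Hom(dual V, tensor3 (dual V)) := ((tpair3 V)^-1 \o dual_map mu)%VF.

Lemma dual_ext V (xi eta : dual V) : (forall x, ev xi x = ev eta x) -> xi = eta.
Proof. by move=> h; apply/(lfunP xi eta). Qed.

Lemma evP V (xi : dual V) a x y : ev xi (a *: x + y) = a * ev xi x + ev xi y.
Proof. by rewrite /ev linearP. Qed.

Lemma evPl V (xi eta : dual V) a x :
  ev (a *: xi + eta) x = a * ev xi x + ev eta x.
Proof. by rewrite /ev add_lfunE scale_lfunE. Qed.

Lemma dual_mapE U V (f : 'Hom(U, V)) xi x : ev (dual_map f xi) x = ev xi (f x).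
Proof.
rewrite /ev linfun_linearE ?comp_lfunE // => a s t.
by rewrite comp_lfunDl comp_lfunZl.
Qed.

Lemma tpair_formE U V (xi : dual U) (eta : dual V) u v :
  ev (tpair_form xi eta) (u ⊗ v) = ev xi u * ev eta v.
Proof.
rewrite /ev tlift_pure //; split=> w a s t; rewrite evP.
  by rewrite mulrDl -mulrA.
by rewrite mulrDr mulrCA.
Qed.

Lemma tpair_formP U V : bilinear_for *:%R *:%R (@tpair_form U V).
Proof.
split=> w a s t; apply: tensor_ext => u v; rewrite add_lfunE scale_lfunE;
  rewrite -![fun_of_lfun _ _]/(ev _ _) !tpair_formE evPl.
  by rewrite mulrDl -mulrA.
by rewrite mulrDr mulrCA.
Qed.

Lemma tpair_pure U V (xi : dual U) (eta : dual V) u v :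
  ev (tpair U V (xi ⊗ eta)) (u ⊗ v) = ev xi u * ev eta v.
Proof. by rewrite tlift_pure ?tpair_formE //; exact: tpair_formP. Qed.

Lemma tpair3_pure V (xi eta gamma : dual V) (x y z : V) :
  ev (tpair3 V (xi ⊗ eta ⊗ gamma)) (x ⊗ y ⊗ z) =
  ev xi x * ev eta y * ev gamma z.
Proof.
by rewrite comp_lfunE tmap_pure id_lfunE !tpair_pure mulrA.
Qed.

Definition dual_basis U (i : 'I_(\dim {:U})) : dual U :=
  linfun (coord (vbasis {:U}) i : U -> K^o).

Definition tunpair_fun U V (phi : dual (tensor U V)) :
    tensor (dual U) (dual V) :=
  \sum_(i < \dim {:U}) \sum_(j < \dim {:V})
    ev phi ((vbasis {:U})`_i ⊗ (vbasis {:V})`_j) *: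
    (dual_basis i ⊗ dual_basis j).

Lemma dual_basisE U (xi : dual U) :
  xi = \sum_(i < \dim {:U}) ev xi (vbasis {:U})`_i *: dual_basis i.
Proof.
apply: dual_ext => x; rewrite /ev sum_lfunE {1}(coord_vbasis (memvf x)).
rewrite linear_sum; apply: eq_bigr => i _.
rewrite linearZ /= scale_lfunE lfunE; exact: mulrC.
Qed.

Lemma tunpair_linear U V : linear (@tunpair_fun U V).
Proof.
move=> a s t; rewrite /tunpair_fun scaler_sumr -big_split /=.
apply: eq_bigr => i _; rewrite scaler_sumr -big_split /=.
by apply: eq_bigr => j _; rewrite evPl scalerDl scalerA.
Qed.

Definition tunpair U V : 'Hom(dual (tensor U V), tensor (dual U) (dual V)) :=
  linfun (@tunpair_fun U V).

Lemma tpure_sum U V (I J : finType) (a : I -> K) (b : J -> K)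
    (x : I -> U) (y : J -> V) :
  (\sum_i a i *: x i) ⊗ (\sum_j b j *: y j) =
  \sum_i \sum_j (a i * b j) *: (x i ⊗ y j).
Proof.
have [l r] := tpure_bilinear U V.
pose fL v : {linear U -> tensor U V} :=
  HB.pack (fun u => u ⊗ v) (GRing.isLinear.Build K U _ *:%R _ (l v)).
pose fR u : {linear V -> tensor U V} :=
  HB.pack (fun v => u ⊗ v) (GRing.isLinear.Build K V _ *:%R _ (r u)).
rewrite -[LHS]/(fL _ _) linear_sum; apply: eq_bigr => i _.
rewrite linearZ /= -[X in _ *: X]/(fR _ _) linear_sum scaler_sumr.
by apply: eq_bigr => j _; rewrite linearZ /= scalerA.
Qed.

Lemma tpairK U V : cancel (tpair U V) (tunpair U V).
Proof.
suff h : (tunpair U V \o tpair U V)%VF = \1%VF.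
  by move=> t; rewrite -comp_lfunE h id_lfunE.
apply: tensor_ext => xi eta; rewrite comp_lfunE id_lfunE.
rewrite (linfun_linearE (@tunpair_linear U V)).
rewrite [in RHS](dual_basisE xi) [in RHS](dual_basisE eta) tpure_sum.
by apply: eq_bigr => i _; apply: eq_bigr => j _; rewrite tpair_pure.
Qed.

Lemma tunpairK U V : cancel (tunpair U V) (tpair U V).
Proof.
move=> phi; apply: tensor_ext => u v.
rewrite (linfun_linearE (@tunpair_linear U V)).
rewrite {2}(coord_vbasis (memvf u)) {2}(coord_vbasis (memvf v)) tpure_sum.
rewrite !linear_sum sum_lfunE; apply: eq_bigr => i _.
rewrite !linear_sum sum_lfunE; apply: eq_bigr => j _.
rewrite !linearZ scale_lfunE -[fun_of_lfun _ (u ⊗ v)]/(ev _ _) tpair_pure.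
rewrite /ev !lfunE; exact: mulrC.
Qed.

Lemma tmapK U V W X (f : 'Hom(U, W)) (f' : 'Hom(W, U))
    (g : 'Hom(V, X)) (g' : 'Hom(X, V)) :
  cancel f f' -> cancel g g' -> cancel (tmap f g) (tmap f' g').
Proof.
move=> fK gK t; rewrite -comp_lfunE.
suff -> : (tmap f' g' \o tmap f g)%VF = \1%VF by rewrite id_lfunE.
by apply: tensor_ext => u v; rewrite comp_lfunE !tmap_pure id_lfunE fK gK.
Qed.

Let tunpair3 V := (tmap \1 (tunpair V V) \o tunpair V (tensor V V))%VF.

Lemma tpair3_bij V : bijective (tpair3 V).
Proof.
exists (tunpair3 V) => t; rewrite !comp_lfunE.
  by rewrite tpairK tmapK //; [move=> x; rewrite !id_lfunE | exact: tpairK].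
by rewrite tmapK ?tunpairK //; [move=> x; rewrite !id_lfunE | exact: tunpairK].
Qed.

Lemma tpair3VK V : cancel (tpair3 V)^-1%VF (tpair3 V).
Proof.
have [g _ gK] := tpair3_bij V.
by move=> phi; rewrite limg_lfunVK // -[phi]gK memv_img ?memvf.
Qed.

Lemma dual_prodE V (Delta : 'Hom(V, tensor3 V)) (xi eta gamma : dual V) x :
  ev (dual_prod Delta (xi ⊗ eta ⊗ gamma)) x =
  ev (tpair3 V (xi ⊗ eta ⊗ gamma)) (Delta x).
Proof. by rewrite comp_lfunE dual_mapE. Qed.

Lemma dual_coprodE V (mu : 'Hom(tensor3 V, V)) (xi : dual V) t :
  ev (tpair3 V (dual_coprod mu xi)) t = ev xi (mu t).
Proof. by rewrite [dual_coprod mu xi]comp_lfunE tpair3VK dual_mapE. Qed.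

End Dual.

(* Main.v *)
Require Import Defs.
From mathcomp Require Import all_boot all_order all_algebra.
Import GRing.Theory.
Local Open Scope ring_scope.

(** In finite dimension the tensor powers of the dual space are the duals of the
tensor powers, through [tpair3] and [tpair5], so every axiom for the dual
structure may be tested by pairing with decomposable tensors. Moving each
structure map across the pairing turns the axioms into one another:
associativity of the dual product is the coassociativity relation of Delta
paired with five forms ([dual_prod_assoc]); coassociativity of the dual
coproduct is the associativity relation of mu seen through one form
([dual_coprod_coassoc]); compatibility is self-dual ([dual_compat]).

Two facts carry the argument. The first is that the pairing is natural: a
tensor product of transposes is the transpose of the tensor product
([tpair3h_natural]), and this remains true of the rebracketings onto fivefold
tensors ([tpair5_flat1], [tpair5_flat2]). The second concerns the
multiplication operators of the dual product. With two arguments fixed, the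
dual product is the transpose of Delta followed by a partial evaluation of the
two corresponding tensor factors ([R_mu_dual_prod], [M_mu_dual_prod],
[L_mu_dual_prod]). Naturality therefore applies to these operators as well.
In the compatibility condition for the dual, the term in L then becomes the
term in R of the original condition and conversely, while the term in M
corresponds to itself. *)

(** * Families that determine linear maps *)

(** Being a generating family, stated through its use: linear maps out of U are
compared on it. In this form the property passes to tensor products, whatever
the bracketing, while [tensor_ext] on nested tensors would leave non-pure
arguments in some slots. *)
Definition separating {K : fieldType} {I : Type} {U : vectType K}
    (s : I -> U) : Prop :=
  forall (W : vectType K) (f g : 'Hom(U, W)),
    (forall i, f (s i) = g (s i)) -> f = g.

Lemma separating_id (K : fieldType) (U : vectType K) :
  separating (fun u : U => u).
Proof. by move=> W f g fg; apply/lfunP. Qed.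

Lemma separating_tensor {K : fieldType} {I J : Type} {U V : vectType K}
    {s : I -> U} {t : J -> V} :
  separating s -> separating t ->
  separating (fun p : I * J => s p.1 ⊗ t p.2).
Proof.
(* One slot is compared at a time, the other one being fixed. *)
move=> sep_s sep_t W f g fg; apply: tensor_ext => u v.
have [l r] := tpure_bilinear U V.
have linl (h : 'Hom(tensor U V, W)) y : linear (fun x => h (x ⊗ y)).
  by move=> a x x'; rewrite l linearP.
have linr (h : 'Hom(tensor U V, W)) x : linear (fun y => h (x ⊗ y)).
  by move=> a y y'; rewrite r linearP.
have fg_s i y : f (s i ⊗ y) = g (s i ⊗ y).
  rewrite -(linfun_linearE (linr f (s i))) -(linfun_linearE (linr g (s i))).
  congr (fun_of_lfun _ y); apply: sep_t => j.
  by rewrite !linfun_linearE //; exact: (fg (i, j)).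
rewrite -(linfun_linearE (linl f v)) -(linfun_linearE (linl g v)).
congr (fun_of_lfun _ u); apply: sep_s => i.
by rewrite !linfun_linearE.
Qed.

Lemma separating_tensor3 {K : fieldType} {I J L : Type} {U V W : vectType K}
    {s : I -> U} {t : J -> V} {r : L -> W} :
  separating s -> separating t -> separating r ->
  separating (fun p : I * (J * L) => s p.1 ⊗ t p.2.1 ⊗ r p.2.2).
Proof.
move=> sep_s sep_t sep_r.
exact: separating_tensor sep_s (separating_tensor sep_t sep_r).
Qed.

Lemma tensor3_ext (K : fieldType) (U X : vectType K)
    (f g : 'Hom(tensor3 U, X)) :
  (forall a b c, f (a ⊗ b ⊗ c) = g (a ⊗ b ⊗ c)) -> f = g.
Proof.
move=> fg; have sep := separating_id K U.
by apply: (separating_tensor3 sep sep sep) => p.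
Qed.

Lemma tensor5_ext (K : fieldType) (U X : vectType K)
    (f g : 'Hom(tensor5 U, X)) :
  (forall a b c d e, f (a ⊗ b ⊗ c ⊗ d ⊗ e) = g (a ⊗ b ⊗ c ⊗ d ⊗ e)) -> f = g.
Proof.
move=> fg; have sep := separating_id K U.
have sep3 := separating_tensor3 sep sep sep.
by apply: (separating_tensor3 sep sep sep3) => p.
Qed.

Lemma flat1_ext (K : fieldType) (U X : vectType K)
    (f g : 'Hom(tensor (tensor3 U) (tensor U U), X)) :
  (forall a b c d e, f ((a ⊗ b ⊗ c) ⊗ d ⊗ e) = g ((a ⊗ b ⊗ c) ⊗ d ⊗ e)) ->
  f = g.
Proof.
move=> fg; have sep := separating_id K U.
have sep3 := separating_tensor3 sep sep sep.
by apply: (separating_tensor3 sep3 sep sep) => p.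
Qed.

Lemma flat2_ext (K : fieldType) (U X : vectType K)
    (f g : 'Hom(tensor U (tensor (tensor3 U) U), X)) :
  (forall a b c d e, f (a ⊗ (b ⊗ c ⊗ d) ⊗ e) = g (a ⊗ (b ⊗ c ⊗ d) ⊗ e)) ->
  f = g.
Proof.
move=> fg; have sep := separating_id K U.
have sep3 := separating_tensor3 sep sep sep.
by apply: (separating_tensor3 sep sep3 sep) => p.
Qed.

(** * The pairing of dual tensors with tensors *)

Section Pairing.
Variable K : fieldType.
Implicit Types U V W X Y Z : vectType K.

Lemma ev_addl V (xi eta : dual V) x : ev (xi + eta) x = ev xi x + ev eta x.
Proof. by rewrite /ev add_lfunE. Qed.

Lemma ev_addr V (xi : dual V) x y : ev xi (x + y) = ev xi x + ev xi y.
Proof. by rewrite /ev linearD. Qed.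

Lemma tmap_comp U V W X Y Z (f : 'Hom(W, Y)) (f' : 'Hom(U, W))
    (g : 'Hom(X, Z)) (g' : 'Hom(V, X)) t :
  tmap f g (tmap f' g' t) = tmap (f \o f')%VF (g \o g')%VF t.
Proof.
rewrite -comp_lfunE; congr (fun_of_lfun _ t).
by apply: tensor_ext => u v; rewrite comp_lfunE !tmap_pure !comp_lfunE.
Qed.

Lemma tmap3_pure U V W X Y Z (f : 'Hom(U, X)) (g : 'Hom(V, Y))
    (h : 'Hom(W, Z)) u v w :
  tmap3 f g h (u ⊗ v ⊗ w) = f u ⊗ g v ⊗ h w.
Proof. by rewrite /tmap3 !tmap_pure. Qed.

Lemma tmap3_comp U V W U1 V1 W1 U2 V2 W2
    (f : 'Hom(U1, U2)) (g : 'Hom(V1, V2)) (h : 'Hom(W1, W2))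
    (f' : 'Hom(U, U1)) (g' : 'Hom(V, V1)) (h' : 'Hom(W, W1)) t :
  tmap3 f g h (tmap3 f' g' h' t) =
  tmap3 (f \o f')%VF (g \o g')%VF (h \o h')%VF t.
Proof.
rewrite /tmap3 tmap_comp; congr (fun_of_lfun (tmap _ _) t).
by apply/lfunP => s; rewrite comp_lfunE tmap_comp.
Qed.

(** Both sides are linear in T and, on pure tensors, evaluate xi at f u and eta
at g v. *)
Lemma tpair_natural U V W X (f : 'Hom(U, W)) (g : 'Hom(V, X)) T :
  tpair U V (tmap (dual_map f) (dual_map g) T) =
  dual_map (tmap f g) (tpair W X T).
Proof.
rewrite -!comp_lfunE; congr (fun_of_lfun _ T).
apply: tensor_ext => xi eta; apply: tensor_ext => u v.
rewrite -!/(ev _ _) !comp_lfunE tmap_pure dual_mapE tpair_pure.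
by rewrite tmap_pure tpair_pure !dual_mapE.
Qed.

(** [tpair3] with three different spaces: naturality with respect to Delta, whose
codomain is a tensor cube, needs the factors to differ. *)
Definition tpair3h U V W :
    'Hom(tensor (dual U) (tensor (dual V) (dual W)),
         dual (tensor U (tensor V W))) :=
  (tpair U (tensor V W) \o tmap \1 (tpair V W))%VF.

Lemma tpair3h_pureE U V W (xi : dual U) (eta : dual V) (gamma : dual W) :
  tpair3h U V W (xi ⊗ eta ⊗ gamma) =
  tpair U (tensor V W) (xi ⊗ tpair V W (eta ⊗ gamma)).
Proof. by rewrite comp_lfunE tmap_pure id_lfunE. Qed.

Lemma tpair3h_pure U V W (xi : dual U) (eta : dual V) (gamma : dual W) u v w :
  ev (tpair3h U V W (xi ⊗ eta ⊗ gamma)) (u ⊗ v ⊗ w) =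
  ev xi u * ev eta v * ev gamma w.
Proof. by rewrite tpair3h_pureE !tpair_pure mulrA. Qed.

Lemma tpair3h_natural U V W X Y Z (f : 'Hom(U, X)) (g : 'Hom(V, Y))
    (h : 'Hom(W, Z)) T t :
  ev (tpair3h U V W (tmap3 (dual_map f) (dual_map g) (dual_map h) T)) t =
  ev (tpair3h X Y Z T) (tmap3 f g h t).
Proof.
rewrite -dual_mapE; congr ev; rewrite !comp_lfunE /tmap3 -tpair_natural.
rewrite !tmap_comp; congr (tpair _ _ (fun_of_lfun (tmap _ _) T)).
  by rewrite comp_lfun1l comp_lfun1r.
by apply/lfunP => s; rewrite !comp_lfunE tpair_natural.
Qed.

Lemma tpair3h_inj U V W : injective (tpair3h U V W).
Proof.
apply: (can_inj (g := (tmap \1 (tunpair V W) \o tunpair U (tensor V W))%VF)).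
move=> t; rewrite !comp_lfunE tpairK tmapK //; last exact: tpairK.
by move=> x; rewrite !id_lfunE.
Qed.

Definition tpair5 V : 'Hom(tensor5 (dual V), dual (tensor5 V)) :=
  (tpair3h V V (tensor3 V) \o tmap3 \1 \1 (tpair3 V))%VF.

Lemma tpair5E V T :
  tpair5 V T = tpair3h V V (tensor3 V) (tmap3 \1 \1 (tpair3 V) T).
Proof. exact: comp_lfunE. Qed.

Lemma tpair5_pure V (a b c d e : dual V) (x y z u v : V) :
  ev (tpair5 V (a ⊗ b ⊗ c ⊗ d ⊗ e)) (x ⊗ y ⊗ z ⊗ u ⊗ v) =
  ev a x * ev b y * (ev c z * ev d u * ev e v).
Proof.
by rewrite tpair5E tmap3_pure !id_lfunE tpair3h_pure tpair3_pure.
Qed.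

Lemma tpair5_inj V : injective (tpair5 V).
Proof.
have [g gK _] := tpair3_bij V.
have g'K : cancel (tpair3 V) (tpair3 V)^-1%VF.
  by move=> t; apply: (can_inj gK); rewrite tpair3VK.
move=> S T; rewrite !tpair5E => /tpair3h_inj; move: S T.
apply: (can_inj (g := tmap \1%VF (tmap \1%VF (tpair3 V)^-1%VF))).
do 2!(apply: tmapK; first by move=> x; rewrite !id_lfunE).
exact: g'K.
Qed.

(** Rebracketing is transposed to rebracketing: the fivefold pairing of flattened
tensors is the nested pairing, in which the first factors are paired by
[tpair3]. *)
Lemma tpair5_flat1 V (T : tensor (tensor3 (dual V)) (tensor (dual V) (dual V)))
    t :
  ev (tpair5 V (flat1 (dual V) T)) (flat1 V t) =
  ev (tpair3h (tensor3 V) V V (tmap3 (tpair3 V) \1 \1 T)) t.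
Proof.
rewrite -dual_mapE; congr (ev _ t).
rewrite -[tpair5 _ _]comp_lfunE -[LHS]comp_lfunE -[RHS]comp_lfunE.
congr (fun_of_lfun _ T); apply: flat1_ext => a b c d e.
rewrite [LHS]comp_lfunE [RHS]comp_lfunE [(tpair5 _ \o _)%VF _]comp_lfunE.
apply: flat1_ext => x y z u v; rewrite -!/(ev _ _) dual_mapE.
rewrite !flat1_pure tpair5_pure.
by rewrite tmap3_pure !id_lfunE tpair3h_pure tpair3_pure !mulrA.
Qed.

Lemma tpair5_flat2 V (T : tensor (dual V) (tensor (tensor3 (dual V)) (dual V)))
    t :
  ev (tpair5 V (flat2 (dual V) T)) (flat2 V t) =
  ev (tpair3h V (tensor3 V) V (tmap3 \1 (tpair3 V) \1 T)) t.
Proof.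
rewrite -dual_mapE; congr (ev _ t).
rewrite -[tpair5 _ _]comp_lfunE -[LHS]comp_lfunE -[RHS]comp_lfunE.
congr (fun_of_lfun _ T); apply: flat2_ext => a b c d e.
rewrite [LHS]comp_lfunE [RHS]comp_lfunE [(tpair5 _ \o _)%VF _]comp_lfunE.
apply: flat2_ext => x y z u v; rewrite -!/(ev _ _) dual_mapE.
rewrite !flat2_pure tpair5_pure.
by rewrite tmap3_pure !id_lfunE tpair3h_pure tpair3_pure !mulrA.
Qed.

(** * Partial evaluation and the operators of the dual product *)

Definition contract_left U V (xi : dual U) : 'Hom(tensor U V, V) :=
  tlift (fun u v => ev xi u *: v).

Definition contract_right U V (eta : dual V) : 'Hom(tensor U V, U) :=
  tlift (fun u v => ev eta v *: u).

Lemma ev_contract_left U V (xi : dual U) (eta : dual V) t :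
  ev eta (contract_left U V xi t) = ev (tpair U V (xi ⊗ eta)) t.
Proof.
rewrite -dual_mapE; congr (ev _ t); apply: tensor_ext => u v.
rewrite -!/(ev _ _) dual_mapE tpair_pure tlift_pure; first exact: linearZ.
split=> w a x y; first by rewrite /= evP scalerDl scalerA.
by rewrite /= scalerDr !scalerA mulrC.
Qed.

Lemma ev_contract_right U V (xi : dual U) (eta : dual V) t :
  ev xi (contract_right U V eta t) = ev (tpair U V (xi ⊗ eta)) t.
Proof.
rewrite -dual_mapE; congr (ev _ t); apply: tensor_ext => u v.
rewrite -!/(ev _ _) dual_mapE tpair_pure tlift_pure.
  by rewrite mulrC; exact: linearZ.
split=> w a x y; last by rewrite /= evP scalerDl scalerA.
by rewrite /= scalerDr !scalerA mulrC.
Qed.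

(** [slice1], [slice2] and [slice3] send a threefold tensor to the factor of that
number, the two others being evaluated at the given forms. *)
Definition slice1 V (eta gamma : dual V) : 'Hom(tensor3 V, V) :=
  contract_right V (tensor V V) (tpair V V (eta ⊗ gamma)).

Definition slice2 V (xi gamma : dual V) : 'Hom(tensor3 V, V) :=
  (contract_right V V gamma \o contract_left V (tensor V V) xi)%VF.

Definition slice3 V (xi eta : dual V) : 'Hom(tensor3 V, V) :=
  (contract_left V V eta \o contract_left V (tensor V V) xi)%VF.

Lemma ev_slice1 V (xi eta gamma : dual V) t :
  ev xi (slice1 V eta gamma t) = ev (tpair3 V (xi ⊗ eta ⊗ gamma)) t.
Proof. by rewrite ev_contract_right -tpair3h_pureE. Qed.

Lemma ev_slice2 V (xi eta gamma : dual V) t :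
  ev eta (slice2 V xi gamma t) = ev (tpair3 V (xi ⊗ eta ⊗ gamma)) t.
Proof.
by rewrite comp_lfunE ev_contract_right ev_contract_left -tpair3h_pureE.
Qed.

Lemma ev_slice3 V (xi eta gamma : dual V) t :
  ev gamma (slice3 V xi eta t) = ev (tpair3 V (xi ⊗ eta ⊗ gamma)) t.
Proof.
by rewrite comp_lfunE !ev_contract_left -tpair3h_pureE.
Qed.

(** The three operators of [dual_prod Delta] as transposes: fixing two forms in
the dual product amounts to slicing Delta along them, which is a map of V. *)
Lemma R_mu_dual_prod V (Delta : 'Hom(V, tensor3 V)) (eta gamma : dual V) :
  R_mu (dual_prod Delta) eta gamma = dual_map (slice1 V eta gamma \o Delta)%VF.
Proof.
apply/lfunP => xi; apply: dual_ext => x.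
by rewrite R_muE dual_prodE dual_mapE comp_lfunE ev_slice1.
Qed.

Lemma M_mu_dual_prod V (Delta : 'Hom(V, tensor3 V)) (xi gamma : dual V) :
  M_mu (dual_prod Delta) xi gamma = dual_map (slice2 V xi gamma \o Delta)%VF.
Proof.
apply/lfunP => eta; apply: dual_ext => x.
by rewrite M_muE dual_prodE dual_mapE comp_lfunE ev_slice2.
Qed.

Lemma L_mu_dual_prod V (Delta : 'Hom(V, tensor3 V)) (xi eta : dual V) :
  L_mu (dual_prod Delta) xi eta = dual_map (slice3 V xi eta \o Delta)%VF.
Proof.
apply/lfunP => gamma; apply: dual_ext => x.
by rewrite L_muE dual_prodE dual_mapE comp_lfunE ev_slice3.
Qed.

(** * The three axioms for the dual *)

Variables (P : vectType K) (alpha1 alpha2 : 'End(P)).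
Implicit Types (mu : 'Hom(tensor3 P, P)) (Delta : 'Hom(P, tensor3 P)).
Let beta1 := dual_map alpha1.
Let beta2 := dual_map alpha2.

Lemma ev_dual_prod_maps Delta U V W (f : 'Hom(P, U)) (g : 'Hom(P, V))
    (h : 'Hom(P, W)) (xi : dual U) (eta : dual V) (gamma : dual W) x :
  ev (dual_prod Delta (dual_map f xi ⊗ dual_map g eta ⊗ dual_map h gamma)) x =
  ev (tpair3h U V W (xi ⊗ eta ⊗ gamma)) (tmap3 f g h (Delta x)).
Proof. by rewrite dual_prodE -tpair3h_natural tmap3_pure. Qed.

(** The inner product is the transpose of Delta applied to a paired triple. The
pairing thus moves it to the element side, where each of the three terms is
the pairing of the five forms with one term of the coassociativity sum. *)
Lemma dual_prod_assoc Delta :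
  partially_hom_coassoc Delta alpha1 alpha2 ->
  partially_hom_assoc (dual_prod Delta) beta1 beta2.
Proof.
move=> coassoc x1 x2 x3 x4 x5; apply: dual_ext => p.
have dualE T : dual_prod Delta T = dual_map Delta (tpair3 P T).
  exact: comp_lfunE.
rewrite !ev_addl [dual_prod Delta (x1 ⊗ _)]dualE [dual_prod Delta (x2 ⊗ _)]dualE.
rewrite [dual_prod Delta (x3 ⊗ _)]dualE !ev_dual_prod_maps.
have -> : tpair3h _ _ _ (tpair3 P (x1 ⊗ x2 ⊗ x3) ⊗ x4 ⊗ x5) =
    tpair3h _ _ _ (tmap3 (tpair3 P) \1%VF \1%VF ((x1 ⊗ x2 ⊗ x3) ⊗ x4 ⊗ x5)).
  by rewrite tmap3_pure !id_lfunE.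
have -> : tpair3h _ _ _ (x1 ⊗ tpair3 P (x2 ⊗ x3 ⊗ x4) ⊗ x5) =
    tpair3h _ _ _ (tmap3 \1%VF (tpair3 P) \1%VF (x1 ⊗ (x2 ⊗ x3 ⊗ x4) ⊗ x5)).
  by rewrite tmap3_pure !id_lfunE.
have -> : tpair3h _ _ _ (x1 ⊗ x2 ⊗ tpair3 P (x3 ⊗ x4 ⊗ x5)) =
    tpair5 P (x1 ⊗ x2 ⊗ x3 ⊗ x4 ⊗ x5).
  by rewrite tpair5E tmap3_pure !id_lfunE.
rewrite -tpair5_flat1 -tpair5_flat2 flat1_pure flat2_pure -!ev_addr.
have /lfunP/(_ p) := coassoc; rewrite !comp_lfunE !add_lfunE !comp_lfunE => ->.
by rewrite !zero_lfunE /ev linear0 zero_lfunE.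
Qed.

Lemma ev_tpair3h_coprod mu (xi : dual P) U V W (f : 'Hom(U, P))
    (g : 'Hom(V, P)) (h : 'Hom(W, P)) t :
  ev (tpair3h U V W (tmap3 (dual_map f) (dual_map g) (dual_map h)
    (dual_coprod mu xi))) t = ev xi (mu (tmap3 f g h t)).
Proof. by rewrite tpair3h_natural -dual_coprodE. Qed.

(** A form xi goes to an element of the fivefold tensor power of the dual, and
[tpair5] is injective. Pairing with a pure tensor undoes each coproduct, since
[tpair3] composed with [dual_coprod mu] is the transpose of mu, and leaves xi
applied to the associativity sum of mu. *)
Lemma dual_coprod_coassoc mu :
  partially_hom_assoc mu alpha1 alpha2 ->
  partially_hom_coassoc (dual_coprod mu) beta1 beta2.
Proof.
move=> assoc; apply/lfunP => xi; apply: tpair5_inj.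
apply: tensor5_ext => a b c d e.
have coprodK : (tpair3 P \o dual_coprod mu)%VF = dual_map mu.
  apply/lfunP => eta; apply: dual_ext => t.
  by rewrite comp_lfunE dual_coprodE dual_mapE.
pose T1 := flat1 (dual P)
  (tmap3 (dual_coprod mu) beta1 beta2 (dual_coprod mu xi)).
pose T2 := flat2 (dual P)
  (tmap3 beta1 (dual_coprod mu) beta2 (dual_coprod mu xi)).
pose T3 := tmap3 beta1 beta2 (dual_coprod mu) (dual_coprod mu xi).
have slot1 : ev (tpair5 P T1) (a ⊗ b ⊗ c ⊗ d ⊗ e) =
    ev xi (mu (mu (a ⊗ b ⊗ c) ⊗ alpha1 d ⊗ alpha2 e)).
  rewrite -flat1_pure tpair5_flat1 tmap3_comp coprodK !comp_lfun1l.
  by rewrite ev_tpair3h_coprod tmap3_pure.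
have slot2 : ev (tpair5 P T2) (a ⊗ b ⊗ c ⊗ d ⊗ e) =
    ev xi (mu (alpha1 a ⊗ mu (b ⊗ c ⊗ d) ⊗ alpha2 e)).
  rewrite -flat2_pure tpair5_flat2 tmap3_comp coprodK !comp_lfun1l.
  by rewrite ev_tpair3h_coprod tmap3_pure.
have slot3 : ev (tpair5 P T3) (a ⊗ b ⊗ c ⊗ d ⊗ e) =
    ev xi (mu (alpha1 a ⊗ alpha2 b ⊗ mu (c ⊗ d ⊗ e))).
  rewrite tpair5E tmap3_comp coprodK !comp_lfun1l.
  by rewrite ev_tpair3h_coprod tmap3_pure.
transitivity (ev (tpair5 P (T1 + T2 + T3)) (a ⊗ b ⊗ c ⊗ d ⊗ e)).
  rewrite [X in tpair5 P X]comp_lfunE !add_lfunE.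
  by rewrite ![(_ \o tmap3 _ _ _)%VF _]comp_lfunE.
rewrite !(linearD (tpair5 P)) !ev_addl slot1 slot2 slot3 -!ev_addr assoc.
by rewrite /ev zero_lfunE !linear0 zero_lfunE.
Qed.

(** Paired with a pure tensor, the left side is three forms paired with Delta of a
product. The term of [compat] with L in the first slot, applied to Delta z,
has the shape xi (mu (alpha1 x ⊗ alpha2 y ⊗ w)), where w is the slice of
Delta z along the two other forms twisted by alpha1 and alpha2. This is the R
term of the dual at x ⊗ y ⊗ z; the M and R terms are read in the same way. *)
Lemma dual_compat mu Delta :
  inf_compatible mu Delta alpha1 alpha2 ->
  inf_compatible (dual_prod Delta) (dual_coprod mu) beta1 beta2.
Proof.
move=> compat xi eta gamma; apply: (bij_inj (tpair3_bij P)).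
apply: tensor3_ext => x y z; rewrite -!/(ev _ _) dual_coprodE dual_prodE compat.
rewrite R_mu_dual_prod M_mu_dual_prod L_mu_dual_prod !linearD !ev_addl.
rewrite !ev_tpair3h_coprod !ev_addr !tmap3_pure.
rewrite ![(_ \o Delta)%VF _]comp_lfunE -R_muE -M_muE -L_muE.
rewrite -[ev gamma _]dual_mapE -[ev eta _]dual_mapE -[ev xi _]dual_mapE.
rewrite ev_slice1 ev_slice2 ev_slice3 -!tpair3h_natural !tmap3_pure.
(* The terms in L, M, R match those in R, M, L, so the sum is reversed. *)
by rewrite [RHS]addrC [X in _ = _ + X]addrC addrA.
Qed.

End Pairing.

Theorem theorem4p9 (K : fieldType) (charK0 : [pchar K] =i pred0)
    (P : vectType K) (mu : 'Hom(tensor3 P, P)) (Delta : 'Hom(P, tensor3 P))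
    (alpha1 alpha2 : 'End(P)) :
  partially_hom_assoc_inf_bialgebra mu Delta alpha1 alpha2 ->
  partially_hom_assoc_inf_bialgebra (dual_prod Delta) (dual_coprod mu)
    (dual_map alpha1) (dual_map alpha2).
Proof.
move=> [assoc coassoc compat]; split.
- exact: dual_prod_assoc.
- exact: dual_coprod_coassoc.
- exact: dual_compat.
Qed.
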